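(* Let $T$ be a nontrivial tree (at least two vertices) of order $n(T)$ with $l(T)$ leaves. Then $$\gamma^{d}_2(T)\geq \frac{n(T)-l(T)+3}{4},$$ with equality if and only if there is a labeling $S$ of $T$ such that $(T,S)\in\mathscr{T}_1$.
   Context: Graphs are finite and simple. For a vertex $v$ of a graph $G$, $N(v)$ is its open neighborhood, $N[v]=N(v)\cup\{v\}$, $d(v)=|N(v)|$, and $d(u,v)$ denotes distance. A leaf is a vertex of degree $1$; a support vertex is a vertex adjacent to a leaf. For a tree $T$, $l(T)$ and $s(T)$ denote the numbers of leaves and of support vertices, and $n(T)$ its order. A set $D\subseteq V(G)$ is a disjunctive dominating set ($2DD$-set) of $G$ if every vertex $v\notin D$ either has a neighbor in $D$ or has at least two vertices of $D$ at distance exactly $2$ from it; a vertex $v$ is said to be $2D$-dominated by $D$ if $N[v]\cap D\neq\emptyset$ or at least two vertices of $D$ are at distance $2$ from $v$. The disjunctive domination number $\gamma^{d}_2(G)$ is the minimum size of a $2DD$-set; a $2DD$-set of that size is a $\gamma^d_2$-set. Labeled trees: a labeling of a tree $T$ is a partition $S=(S_A,S_B,S_C,S_D)$ of $V(T)$ into four (possibly empty) sets; the status $\mathrm{sta}(v)\in\{A,B,C,D\}$ is the letter $x$ with $v\in S_x$. Operation $\mathscr{O}_1$: choose a vertex $v$ with $\mathrm{sta}(v)=A$; add a new vertex $u$ and the edge $uv$, with $\mathrm{sta}(u)=C$. Operation $\mathscr{O}_3$: choose a vertex $v$ with $\mathrm{sta}(v)=C$ and $d(v)=1$; add a new path $u_1u_2u_3u_4$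 and the edge $u_1v$, with $\mathrm{sta}(u_1)=D$, $\mathrm{sta}(u_2)=B$, $\mathrm{sta}(u_3)=A$, $\mathrm{sta}(u_4)=C$. (Existing vertices keep their statuses.) $\mathscr{T}_1$ is the smallest family of labeled trees that contains $(P_3,S')$, where $S'$ gives both leaves of $P_3$ status $C$ and the central vertex status $A$, and is closed under $\mathscr{O}_1$ and $\mathscr{O}_3$. *)

(* Defs.v *)
From mathcomp Require Import all_boot.
Set Implicit Arguments. Unset Strict Implicit. Unset Printing Implicit Defensive.

Definition simple_graph (V : finType) (e : rel V) : Prop :=
  symmetric e /\ irreflexive e.

Definition acyclic (V : finType) (e : rel V) : Prop :=
  forall (x : V) (p : seq V),
    path e x p -> uniq (x :: p) -> 2 <= size p -> ~~ e (last x p) x.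

Definition is_tree (V : finType) (e : rel V) : Prop :=
  [/\ simple_graph e, (forall x y : V, connect e x y) & acyclic e].

Definition deg (V : finType) (e : rel V) (v : V) : nat := #|[set u | e v u]|.

Definition nleaves (V : finType) (e : rel V) : nat :=
  #|[set v : V | deg e v == 1]|.

Definition dist2 (V : finType) (e : rel V) (u v : V) : bool :=
  [&& u != v, ~~ e u v & [exists w, e u w && e w v]].

Definition is2DD (V : finType) (e : rel V) (D : {set V}) : bool :=
  [forall v, (v \notin D) ==>
     ([exists u in D, e v u] || (2 <= #|[set u in D | dist2 e v u]|))].

(* gamma^d_2: minimum size of a 2DD-set (setT is always a 2DD-set). *)
Definition gamma2d (V : finType) (e : rel V) : nat :=
  #|[arg min_(D < [set: V] | is2DD e D) #|D|]|.

Inductive status := SA | SB | SC | SD.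

(* Concrete labeled trees on vertex set {0,...,k-1} given by an edge list
   and a status function. *)
Definition adjE (E : seq (nat * nat)) (a b : nat) : bool :=
  ((a, b) \in E) || ((b, a) \in E).

Definition degE (E : seq (nat * nat)) (v : nat) : nat :=
  count (fun p => (p.1 == v) || (p.2 == v)) E.

Inductive T1b : nat -> seq (nat * nat) -> (nat -> status) -> Prop :=
| T1_base : T1b 3 [:: (0, 1); (1, 2)] (fun i => if i == 1 then SA else SC)
| T1_O1 k E s v :
    T1b k E s -> v < k -> s v = SA ->
    T1b k.+1 ((v, k) :: E) (fun i => if i == k then SC else s i)
| T1_O3 k E s v :
    T1b k E s -> v < k -> s v = SC -> degE E v = 1 ->
    T1b (k + 4) ((v, k) :: (k, k.+1) :: (k.+1, k.+2) :: (k.+2, k.+3) :: E)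
        (fun i => if i == k then SD else if i == k.+1 then SB
                  else if i == k.+2 then SA else if i == k.+3 then SC
                  else s i).

Definition inT1 (V : finType) (e : rel V) (S : V -> status) : Prop :=
  exists k E s (f : V -> nat),
    [/\ T1b k E s, injective f, (forall v, f v < k), #|V| = k &
        (forall u v, e u v = adjE E (f u) (f v)) /\
        (forall v, S v = s (f v))].

(* Main.v *)
(* Let D be a 2DD-set, X the vertices outside D with a neighbour in D, Y the rest.
   Since the degrees of a tree sum to 2n - 2, the bound n - l + 3 <= 4|D| follows
   from sum_v (2 [deg v <> 1] + 6) <= sum_v (8 [v in D] + 3 deg v), which is proved
   by discharging: a vertex of D sends 3 to each neighbour in X, and a vertex of X
   sends to each neighbour in Y either 1 or 3, according to whether it has one or
   several neighbours in D.  In case of equality every local inequality is tight: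
   D is independent without leaves, vertices of X have a single neighbour in D and
   are leaves or have degree 2 with a neighbour in Y, and vertices of Y have degree
   2 with both neighbours in X.  Such a tree is rebuilt from a P_3 centred in D by
   attaching leaves at D (O_1) and paths Y-X-D-X at leaves (O_3). *)
Require Import Defs.
From mathcomp Require Import all_boot zify.

Set Implicit Arguments.
Unset Strict Implicit.
Unset Printing Implicit Defensive.

(** * Edge bound for acyclic graphs *)

Lemma sum_bool_card (T : finType) (A : {set T}) (P : pred T) :
  \sum_(x in A) P x = #|[set x in A | P x]|.
Proof.
by rewrite -sum1dep_card big_mkcondr; apply: eq_bigr => x _; case: (P x).
Qed.

Section Forest.
Variables (V : finType) (e : rel V).
Hypotheses (e_sym : symmetric e) (e_irr : irreflexive e) (e_acy : acyclic e).

(* Otherwise a path in [W] could be extended at its head forever: a neighbour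
   of the head lying further along the path would close a cycle. *)
Lemma acyclic_low_degree (W : {set V}) :
  W != set0 -> exists2 v, v \in W & \sum_(u in W) e v u <= 1.
Proof.
case/set0Pn=> w Ww; apply/exists_inP; apply: contraT => /exists_inPn/= W2.
suff [x [p [_ x_uniq _ sz]]]: exists x p,
    [/\ path e x p, uniq (x :: p), {subset x :: p <= W} & size p = #|V|].
  by have := max_card (mem (x :: p)); rewrite (card_uniqP x_uniq) /= sz ltnn.
elim: #|V| => [|n [x [p [xp x_uniq xW <-]]]].
  by exists w, [::]; split=> // z; rewrite inE => /eqP->.
have /W2: x \in W by apply: xW; rewrite mem_head.
rewrite -ltnNge sum_bool_card => /card_gt1P[a [b]].
rewrite !inE => -[/andP[Wa xa] /andP[Wb xb] ab].
(* The default [z] of [head] makes the claim void for empty [p]; that case is settled further on by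
   irreflexivity. *)
have head_nbr z : e x z -> z \in x :: p -> z = head z p.
  rewrite inE => xz; have -> /= : (z == x) = false.
    by apply: contraTF xz => /eqP->; rewrite e_irr.
  move=> /splitPr pz; case: pz xp x_uniq {xW} => [[|y p1] p2] //= xp x_uniq.
  have := @e_acy x (y :: rcons p1 z); rewrite /= last_rcons size_rcons (e_sym z) xz.
  rewrite -cat_rcons cat_path in xp x_uniq; move: xp => /and3P[-> -> _].
  move: x_uniq; rewrite !inE !mem_cat cat_uniq !negb_or.
  by case/and3P=> /and3P[-> -> _] /andP[-> _] /and3P[-> _ _] /(_ isT isT isT).
have [y [Wy xy yp]]: exists y, [/\ y \in W, e x y & y \notin x :: p].
  have [pa|] := boolP (a \in x :: p); last by exists a.
  have [pb|] := boolP (b \in x :: p); last by exists b.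
  have := head_nbr b xb pb; have := head_nbr a xa pa.
  case: (p) pa => [|y q _ /= aE bE]; last by rewrite aE bE eqxx in ab.
  by rewrite inE => /eqP ax; rewrite ax e_irr in xa.
exists y, (x :: p); split=> //=; first by rewrite e_sym xy.
  by rewrite yp.
by move=> z; rewrite inE => /predU1P[->|/xW].
Qed.

(** Induction on the size of [W]: deleting a vertex with at most one neighbour in [W] lowers the
    left side, where every edge counts twice, by at most 2, and the right side by exactly 2. *)
Lemma acyclic_edge_bound (W : {set V}) :
  W != set0 -> \sum_(v in W) \sum_(u in W) e v u + 2 <= 2 * #|W|.
Proof.
have [n] := ubnP #|W|; elim: n W => // n IHn W W_n W0.
have [v Wv v_le1] := acyclic_low_degree W0.
have [WE|W'0] := eqVneq (W :\ v) set0.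
  rewrite (big_setD1 v) //= WE big_set0 (big_setD1 v) //= WE big_set0.
  by rewrite (cardsD1 v) Wv WE cards0 e_irr.
have := IHn (W :\ v); rewrite (cardsD1 v W) Wv in W_n *.
move/(_ ltac:(lia) W'0).
have -> : \sum_(x in W) \sum_(u in W) e x u =
    2 * (\sum_(u in W) e v u) + \sum_(x in W :\ v) \sum_(u in W :\ v) e x u.
  rewrite (big_setD1 v) //= mul2n -addnn -addnA; congr (_ + _).
  rewrite [in RHS](big_setD1 v) //= e_irr add0n -big_split /=.
  by apply: eq_bigr => x _; rewrite (big_setD1 v) //= e_sym.
lia.
Qed.
End Forest.

(** * Discharging rules and local balance *)

Section Discharging.
Variables (V : finType) (e : rel V) (D : {set V}).

(** [near] and [far] are the sets X and Y of the discharging. *)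
Definition near := [set v | (v \notin D) && [exists u in D, e v u]].
Definition far := [set v | (v \notin D) && ~~ [exists u in D, e v u]].

(** Written as a sum over all vertices, so that it compares term by term with sums of [flow]. *)
Definition ncount (v : V) (A : {set V}) : nat := \sum_u e v u * (u \in A).

(** The amount 3 serves a far vertex whose two dominators are both reached through the same near
    neighbour; that neighbour can afford it because each further neighbour in [D] brings it 3
    more. *)
Definition rate (v : V) : nat := if ncount v D == 1 then 1 else 3.

Definition flow (u v : V) : nat :=
  e u v * (3 * ((u \in D) && (v \notin D)) +
           rate u * ((u \in near) && (v \in far))).

Lemma ncount_card v A : ncount v A = #|[set u in A | e v u]|.
Proof.
rewrite -sum_bool_card [RHS]big_mkcond; apply: eq_bigr => u _ /=.
by case: (u \in A); rewrite ?muln1 ?muln0.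
Qed.

Lemma deg_sum v : deg e v = \sum_u e v u.
Proof.
rewrite /deg (eq_bigl (fun u => u \in [set: V])); last by move=> u; rewrite inE.
by rewrite sum_bool_card; apply: eq_card => u; rewrite !inE.
Qed.

Lemma deg_ncount v : deg e v = ncount v D + ncount v near + ncount v far.
Proof.
rewrite deg_sum -!big_split; apply: eq_bigr => u _ /=; rewrite !inE.
by case: (u \in D); case: [exists _ in D, _]; case: (e v u).
Qed.

Lemma ncount_gt0 v u (A : {set V}) : e v u -> u \in A -> 0 < ncount v A.
Proof.
by move=> vu Au; rewrite ncount_card; apply/card_gt0P; exists u; rewrite !inE Au.
Qed.

Lemma ncount_ge2 v u w (A : {set V}) :
  e v u -> e v w -> u \in A -> w \in A -> u != w -> 2 <= ncount v A.
Proof.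
move=> vu vw Au Aw uw; rewrite ncount_card; apply/card_gt1P; exists u, w.
by rewrite !inE vu vw Au Aw.
Qed.

Lemma ncount_le1 v u w (A : {set V}) :
  ncount v A <= 1 -> e v u -> e v w -> u \in A -> w \in A -> u = w.
Proof.
move=> le1 vu vw Au Aw; apply/eqP; apply: contraLR le1 => uw.
by rewrite -ltnNge (ncount_ge2 vu vw).
Qed.

Lemma ncount_near v : v \in near -> 0 < ncount v D.
Proof. by rewrite inE => /andP[_ /exists_inP[u Du vu]]; apply: ncount_gt0 vu Du. Qed.

Lemma ncount_far v : v \in far -> ncount v D = 0.
Proof.
rewrite inE => /andP[_ /exists_inPn noD]; apply: big1 => u _.
by have [/noD/negPf-> | _] := boolP (u \in D); rewrite ?muln0.
Qed.

Lemma near_notin v : v \in near -> (v \in D) = false.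
Proof. by rewrite inE => /andP[/negPf]. Qed.

Lemma far_notin v : v \in far -> (v \in D) = false.
Proof. by rewrite inE => /andP[/negPf]. Qed.

Lemma far_not_near v : v \in far -> (v \in near) = false.
Proof. by rewrite !inE => /andP[-> /negPf]. Qed.

Lemma vertexP v : [\/ v \in D, v \in near | v \in far].
Proof.
rewrite !inE; case: (v \in D); first exact: Or31.
by case: [exists _ in D, _]; [exact: Or32 | exact: Or33].
Qed.

Hypotheses (e_sym : symmetric e) (D_2DD : is2DD e D).
Hypothesis deg_gt0 : forall v, 0 < deg e v.

(** Outflow counts as demand and inflow as supply, so that the flow cancels when both are summed
    over all vertices. *)
Definition demand v := 2 * (deg e v != 1) + 6 + \sum_u flow v u.
Definition supply v := 8 * (v \in D) + 3 * deg e v + \sum_u flow u v.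

(** The two dominators at distance 2 are reached through midpoints, which are near. Distinct
    midpoints give the first case, a common midpoint the second. *)
Lemma far_supply y : y \in far ->
  2 <= ncount y near \/ exists x, [/\ x \in near, e y x & 2 <= ncount x D].
Proof.
move=> yF; have := yF; rewrite inE => /andP[yD yD'].
move: (forallP D_2DD y); rewrite yD (negPf yD') /= => /card_gt1P[u1 [u2]].
rewrite !inE => -[/and4P[D1 _ _ /existsP[w1 /andP[yw1 wu1]]]].
move=> /and4P[D2 _ _ /existsP[w2 /andP[yw2 wu2]]] u12.
have mid w u : u \in D -> e y w -> e w u -> w \in near.
  move=> Du yw wu; rewrite inE; apply/andP; split; last by apply/exists_inP; exists u.
  by apply: contra yD' => Dw; apply/exists_inP; exists w.
have [wE|w12] := eqVneq w1 w2.
  right; exists w1; split=> //; first exact: mid D1 yw1 wu1.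
  by apply: ncount_ge2 wu1 _ D1 D2 u12; rewrite wE.
by left; apply: (ncount_ge2 yw1 yw2) => //; [apply: mid D1 yw1 _ | apply: mid D2 yw2 _].
Qed.

Lemma flow_out_D v : v \in D -> \sum_u flow v u + 3 * ncount v D = 3 * deg e v.
Proof.
move=> Dv; rewrite deg_sum /ncount !big_distrr -big_split; apply: eq_bigr => u _ /=.
by rewrite /flow !inE Dv /=; case: (u \in D); case: (e v u); rewrite /= ?muln0 ?addn0.
Qed.

Lemma flow_out_near v : v \in near -> \sum_u flow v u = rate v * ncount v far.
Proof.
move=> vN; have := vN; rewrite inE => /andP[/negPf vD _].
rewrite big_distrr; apply: eq_bigr => u _ /=; rewrite /flow vD vN /=; lia.
Qed.

Lemma flow_out_far v : v \in far -> \sum_u flow v u = 0.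
Proof.
move=> vF; apply: big1 => u _; rewrite /flow.
by move: vF; rewrite !inE => /andP[/negPf-> /negPf->] /=; rewrite !muln0.
Qed.

Lemma flow_in_near v : v \in near -> \sum_u flow u v = 3 * ncount v D.
Proof.
move=> vN; have := vN; rewrite inE => /andP[vD nb].
rewrite big_distrr; apply: eq_bigr => u _ /=.
by rewrite /flow e_sym vD !inE nb !andbF muln0 addn0 andbT; lia.
Qed.

Lemma flow_in_far v :
  v \in far -> \sum_u flow u v = \sum_u e v u * (rate u * (u \in near)).
Proof.
move=> vF; have := ncount_far vF; rewrite ncount_card => /cards0_eq noD.
apply: eq_bigr => u _; rewrite /flow e_sym vF andbT.
have := in_set0 u; rewrite -noD inE.
by case: (u \in D) => /= euv; rewrite ?euv.
Qed.

Lemma flow_in_far_ge v : v \in far -> ncount v near <= \sum_u flow u v.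
Proof.
move=> vF; rewrite flow_in_far //; apply: leq_sum => u _.
by rewrite leq_mul2l leq_pmull ?orbT // /rate; case: ifP.
Qed.

(** Necessary conditions for local equality. The last alternative cannot be excluded at a far vertex
    by itself; tightness of [x] excludes it later. *)
Definition tight v :=
  if v \in D then ncount v D = 0 /\ deg e v != 1
  else if v \in near then
    ncount v D = 1 /\ (deg e v = 1 \/ deg e v = 2 /\ ncount v far = 1)
  else (deg e v = 2 /\ ncount v near = 2) \/
       exists x, [/\ x \in near, e v x & 2 <= ncount x D].

Lemma local_balance v : demand v <= supply v /\ (demand v = supply v -> tight v).
Proof.
rewrite /demand /supply /tight; have d0 := deg_gt0 v; have degE := deg_ncount v.
case: (vertexP v) => vA.
- by rewrite vA; have := flow_out_D vA; case: eqP => /= *; lia.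
- rewrite near_notin // vA flow_out_near // flow_in_near // /rate; have := ncount_near vA.
  by case: eqP => c1; case: eqP => /= *; lia.
rewrite far_notin // far_not_near // flow_out_far //; have D0 := ncount_far vA.
have inge := flow_in_far_ge vA.
have [N2|[x [xN vx xD]]] := far_supply vA.
  have -> /= : deg e v != 1 by lia.
  by split=> [|?]; last left; lia.
(* The single vertex [x] sends 3; with 3 times the degree this covers 6 at a leaf and 8
   elsewhere. *)
have in3 : 3 <= \sum_u flow u v.
  rewrite flow_in_far // (bigD1 x) //= vx xN /rate; case: eqP => ?; lia.
split; first by case: eqP => /= *; lia.
by right; exists x.
Qed.

Lemma flow_balance : \sum_v \sum_u flow v u = \sum_v \sum_u flow u v.
Proof. exact: exchange_big. Qed.

End Discharging.

(** * Global counting and the lower bound *)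

Lemma acyclic_deg_bound (V : finType) (e : rel V) :
  symmetric e -> irreflexive e -> acyclic e -> 0 < #|V| ->
  \sum_v deg e v + 2 <= 2 * #|V|.
Proof.
move=> e_sym e_irr e_acy V0; rewrite -cardsT in V0 *.
have := acyclic_edge_bound e_sym e_irr e_acy (W := setT).
rewrite -card_gt0 => /(_ V0); congr (_ + _ <= _).
rewrite big_mkcond; apply: eq_bigr => v _; rewrite inE deg_sum big_mkcond.
by apply: eq_bigr => u _; rewrite inE.
Qed.

Lemma connected_deg_gt0 (V : finType) (e : rel V) :
  (forall x y, connect e x y) -> 2 <= #|V| -> forall v, 0 < deg e v.
Proof.
move=> e_conn V2 v; rewrite -cardsT (cardsD1 v) inE in V2.
have /card_gt0P[u] : 0 < #|[set: V] :\ v| by [].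
rewrite !inE andbT => uv; have /connectP[[|w p] /= vp uE] := e_conn v u.
  by rewrite uE eqxx in uv.
by apply/card_gt0P; exists w; rewrite inE; case/andP: vp.
Qed.

Lemma nonleaf_card (V : finType) (e : rel V) :
  #|V| - nleaves e = \sum_v (deg e v != 1).
Proof.
rewrite -sum1_card /nleaves -sum1dep_card [X in _ - X]big_mkcond.
apply/eqP; rewrite -(eqn_add2r (\sum_v if deg e v == 1 then 1 else 0)) subnK.
  by rewrite -big_split; apply/eqP/eq_bigr => v _; case: eqP.
by apply: leq_sum => v _; case: eqP.
Qed.

Lemma other_nbr (V : finType) (e : rel V) v x :
  1 < deg e v -> exists2 y, e v y & y != x.
Proof.
case/card_gt1P=> a [b [+ + ab]]; rewrite !inE => va vb.
have [ax|] := eqVneq a x; last by exists a.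
by exists b; rewrite // -ax eq_sym.
Qed.

(** Summing the local inequalities cancels the flow and leaves $2(n-l)+6n \le 8|D| + 3\sum_v d(v)$,
    where the degree sum is at most $2n-2$. In case of equality there is no slack for a strict local
    inequality. *)
Lemma tree_2DD_bound (V : finType) (e : rel V) (D : {set V}) :
  is_tree e -> 2 <= #|V| -> is2DD e D ->
  #|V| - nleaves e + 3 <= 4 * #|D| /\
  (4 * #|D| = #|V| - nleaves e + 3 -> forall v, tight e D v).
Proof.
move=> [[e_sym e_irr] e_conn e_acy] V2 D_2DD.
have deg0 := connected_deg_gt0 e_conn V2.
have local := local_balance e_sym D_2DD deg0.
have V0 : 0 < #|V| by lia.
have degb := acyclic_deg_bound e_sym e_irr e_acy V0.
have demE : \sum_v demand e D v =
    2 * (#|V| - nleaves e) + 6 * #|V| + \sum_v \sum_u flow e D v u.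
  by rewrite nonleaf_card 2!big_split -big_distrr /= sum_nat_const [6 * _]mulnC.
have supE : \sum_v supply e D v =
    8 * #|D| + 3 * \sum_v deg e v + \sum_v \sum_u flow e D u v.
  by rewrite 2!big_split -!big_distrr /= -sum1_card [\sum_(v in D) _]big_mkcond.
rewrite -flow_balance in supE.
have : \sum_v demand e D v <= \sum_v supply e D v.
  by apply: leq_sum => v _; exact: (local v).1.
rewrite demE supE => le; split; first by lia.
move=> eq4 v; apply: (local v).2; apply/eqP; rewrite eqn_leq (local v).1 /= leqNgt.
apply/negP => lt; have : \sum_v demand e D v < \sum_v supply e D v.
  rewrite (bigD1 v) //= [X in _ < X](bigD1 v) //= -addSn leq_add //.
  by apply: leq_sum => u _; exact: (local u).1.
by rewrite demE supE; lia.
Qed.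

(** * Local structure in the case of equality *)

Section Tight.
Variables (V : finType) (e : rel V) (D : {set V}).
Hypotheses (e_sym : symmetric e) (tightD : forall v, tight e D v).

(** A tight near vertex has only one neighbour in [D], which rules out the second alternative of
    [tight]. *)
Lemma tight_far v : v \in far e D -> deg e v = 2 /\ ncount e v (near e D) = 2.
Proof.
move=> vF; have := tightD v; rewrite /tight (far_notin vF) (far_not_near vF).
case=> // -[x [xN _]]; have := tightD x; rewrite /tight (near_notin xN) xN; lia.
Qed.

Lemma tight_near v : v \in near e D ->
  ncount e v D = 1 /\ (deg e v = 1 \/ deg e v = 2 /\ ncount e v (far e D) = 1).
Proof. by move=> vN; have := tightD v; rewrite /tight (near_notin vN) vN. Qed.

Lemma near_nbr d x : d \in D -> e d x -> x \in near e D.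
Proof.
move=> Dd dx; rewrite inE; apply/andP; split.
  apply: contraTN isT => Dx; have := tightD d; rewrite /tight Dd.
  by have := ncount_gt0 dx Dx; lia.
by apply/exists_inP; exists d; rewrite // e_sym.
Qed.

Lemma near_center_unique x d d' :
  x \in near e D -> d \in D -> d' \in D -> e x d -> e x d' -> d = d'.
Proof.
by move=> /tight_near[x1 _] Dd Dd' xd xd'; apply: (@ncount_le1 _ e x d d' D); rewrite ?x1.
Qed.

(** The neighbours [d] and [u] are distinct, so [x] is not a leaf and tightness gives it exactly one
    neighbour in [D] and one in [far]. *)
Lemma near_nbrs x d u w : x \in near e D -> d \in D -> e x d -> u \notin D ->
  e x u -> e x w -> u \in far e D /\ (w = d \/ w = u).
Proof.
move=> xN Dd xd uD xu xw; have [x1 [d1|[d2 f1]]] := tight_near xN.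
  have := @ncount_ge2 _ e x d u setT xd xu (in_setT _) (in_setT _).
  have -> : ncount e x setT = deg e x.
    by rewrite deg_sum; apply: eq_bigr => z _; rewrite inE muln1.
  by rewrite d1; case: eqP uD => [<-|_ _ /(_ isT)//]; rewrite Dd.
(* Degree 2 is used up by the neighbour in [D] and the far one, so no neighbour of [x] is near. *)
have := deg_ncount e D x; rewrite d2 f1 x1 => near0.
have nn z : e x z -> (z \in near e D) = false.
  by move=> xz; apply/negP=> zN; have := ncount_gt0 xz zN; lia.
have uF : u \in far e D by case: (vertexP e D u) uD (nn u xu) => ->.
split=> //; case: (vertexP e D w) => wA; last 1 first.
- by right; apply: (@ncount_le1 _ e x w u (far e D)); rewrite ?f1.
- by left; apply: near_center_unique xN _ _ _ _.
by rewrite nn in wA.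
Qed.

Lemma center_deg d : d \in D -> deg e d != 1.
Proof. by move=> Dd; have := tightD d; rewrite /tight Dd => -[]. Qed.

Lemma far_nbrs y x : y \in far e D -> e y x -> exists x',
  [/\ x' != x, e y x', x \in near e D, x' \in near e D &
      forall w, e y w -> w = x \/ w = x'].
Proof.
move=> yF yx; have [d2 n2] := tight_far yF.
have nbr_near w : e y w -> w \in near e D.
  move=> yw; have := deg_ncount e D y; rewrite d2 n2.
  by case: (vertexP e D w) => // wA; have := ncount_gt0 yw wA; lia.
have [|x' yx' x'x] := @other_nbr _ e y x; first by rewrite d2.
exists x'; split; rewrite ?nbr_near // => w yw.
move/eqP: d2 => /cards2P[a [b [ab nE]]].
have in2 z : e y z -> z = a \/ z = b.
  by move=> yz; have := in_set2 z a b; rewrite -nE inE yz => /esym/orP[]/eqP; auto.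
case: (in2 _ yx) (in2 _ yx') (in2 _ yw) x'x => -> [] -> [] -> nx;
  by first [by rewrite eqxx in nx | by left | by right].
Qed.
End Tight.

(** * Edge lists of labelled trees *)

Arguments degE E v : simpl never.

Lemma degE_cons p E i : degE (p :: E) i = ((p.1 == i) || (p.2 == i)) + degE E i.
Proof. by []. Qed.

(** Listing the smaller end first excludes loops and an edge occurring in both orientations, so such
    a list describes a simple graph. *)
Definition edges_ok (k : nat) (E : seq (nat * nat)) : bool :=
  uniq E && all (fun p => p.1 < p.2 < k) E.

(** The larger end of each pair of [F] is a new vertex, hence [F] and [E] are disjoint. *)
Lemma edges_ok_cat k k' E F : edges_ok k E -> k <= k' -> uniq F ->
  all (fun p => p.1 < p.2 < k') F -> all (fun p => k <= p.2) F ->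
  edges_ok k' (F ++ E).
Proof.
case/andP=> Eu /allP Ek kk' Fu Fk' Fk; rewrite /edges_ok cat_uniq all_cat Fu Eu Fk'.
rewrite !andbT /=; apply/andP; split.
  by apply/hasPn=> p /Ek /= pk; apply/negP=> /(allP Fk) /=; lia.
by apply/allP=> p /Ek /=; lia.
Qed.

Lemma T1b_edges k E s : T1b k E s -> edges_ok k E /\ size E + 1 = k.
Proof.
elim=> {k E s} [|k E s v _ [E_ok sz] vk _|k E s v _ [E_ok sz] vk _ _] //.
  split; last by rewrite /=; lia.
  by apply: (edges_ok_cat (F := [:: (v, k)]) E_ok) => //=; lia.
split; last by rewrite /=; lia.
apply: (edges_ok_cat (F := [:: (v, k); (k, k.+1); (k.+1, k.+2); (k.+2, k.+3)]) E_ok);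
  rewrite /= ?inE ?xpair_eqE; lia.
Qed.

Lemma degE_sum k E i : edges_ok k E -> degE E i = \sum_(j < k) adjE E i j.
Proof.
case/andP; elim: E => [|[a b] E IHE] /=; first by rewrite big1.
case/andP=> abE Eu /andP[abk Ek]; rewrite degE_cons IHE //.
have baE : (b, a) \notin E by apply/negP=> /(allP Ek) /=; lia.
have [a_k b_k] : a < k /\ b < k by lia.
have sum1 c d : d < k -> \sum_(j < k) ((i == c) && (j == d :> nat)) = (i == c) :> nat.
  move=> dk; rewrite (bigD1 (Ordinal dk)) //= eqxx andbT big1 ?addn0 // => j.
  by rewrite -val_eqE => /negPf/= ->; rewrite andbF.
have -> : (a == i) || (b == i) = \sum_(j < k) ((i == a) && (j == b :> nat)) +
    \sum_(j < k) ((i == b) && (j == a :> nat)) :> nat.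
  by rewrite !sum1 // (eq_sym a) (eq_sym b); case: eqP => [->|] //; rewrite ltn_eqF //; case/andP: abk.
rewrite -!big_split; apply: eq_bigr => j _; rewrite /adjE !inE !xpair_eqE /= [_ && (i == b)]andbC.
have [/andP[/eqP-> /eqP->]|_] := boolP ((i == a) && (j == b :> nat)).
  by rewrite (negPf abE) (negPf baE) /=; lia.
have [/andP[/eqP-> /eqP->]|_] := boolP ((i == b) && (j == a :> nat)).
  by rewrite (negPf abE) (negPf baE) /=; lia.
by rewrite !add0n.
Qed.

Lemma degE_out k E i : edges_ok k E -> k <= i -> degE E i = 0.
Proof.
case/andP=> _ /allP Ek ki; apply/eqP; rewrite -leqn0 leqNgt -has_count.
by apply/hasPn=> p /Ek /=; lia.
Qed.

Lemma sum_degE k E : edges_ok k E -> \sum_(i < k) degE E i = 2 * size E.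
Proof.
case/andP=> _; elim: E => [|[a b] E IHE] /=; first by rewrite big1.
case/andP=> abk /IHE {}IHE.
have [a_k b_k] : a < k /\ b < k by lia.
have -> : \sum_(i < k) degE ((a, b) :: E) i =
    \sum_(i < k) (i == a :> nat) + \sum_(i < k) (i == b :> nat) + \sum_(i < k) degE E i.
  rewrite -!big_split; apply: eq_bigr => i _ /=.
  by rewrite degE_cons /=; congr (_ + _); lia.
rewrite IHE; have sum1 c : c < k -> \sum_(i < k) (i == c :> nat) = 1.
  move=> ck; rewrite (bigD1 (Ordinal ck)) //= eqxx big1 // => i.
  by rewrite -val_eqE => /negPf/= ->.
rewrite !sum1 //; lia.
Qed.

(** * The vertices of status A form a 2DD-set attaining the bound *)

Definition isA (x : status) : bool := if x is SA then true else false.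

Lemma isAP x : reflect (x = SA) (isA x).
Proof. by case: x; constructor. Qed.

(** A folded name for the status function of [T1_O3], convertible with it. *)
Definition status_O3 (k : nat) (s : nat -> status) (i : nat) : status :=
  if i == k then SD else if i == k.+1 then SB
  else if i == k.+2 then SA else if i == k.+3 then SC else s i.

Arguments status_O3 : simpl never.

Lemma status_O3_old k s i : i < k -> status_O3 k s i = s i.
Proof. by move=> ik; rewrite /status_O3; do 4 (case: eqP => [|_]; first by lia). Qed.

Lemma status_O3_new k s : [/\ status_O3 k s k = SD, status_O3 k s k.+1 = SB,
  status_O3 k s k.+2 = SA & status_O3 k s k.+3 = SC].
Proof. by split; rewrite /status_O3; do 4?[case: eqP => //; try lia]. Qed.

(** The invariant attached to each status. Status A asks for degree at least 2, so that attaching a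
    leaf there creates no new non-leaf. Status D asks only for walks of length 2; exact distance 2
    is recovered where no neighbour has status A. *)
Definition dominatedE k E (s : nat -> status) i : Prop :=
  match s i with
  | SA => 1 < degE E i
  | SB | SC => exists j, [/\ j < k, adjE E i j & s j = SA]
  | SD => exists w w' a a', [/\ a != a', [/\ w < k, w' < k, a < k & a' < k],
      adjE E i w && adjE E w a, adjE E i w' && adjE E w' a' & s a = SA /\ s a' = SA]
  end.

(** Each condition survives the addition of vertices and edges as long as old statuses are kept. *)
Lemma dominatedE_ext k k' F E s s' i :
  i < k -> k <= k' -> (forall j, j < k -> s' j = s j) ->
  dominatedE k E s i -> dominatedE k' (F ++ E) s' i.
Proof.
move=> ik kk' ss; rewrite /dominatedE ss //.
have adjF x y : adjE E x y -> adjE (F ++ E) x y.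
  by rewrite /adjE !mem_cat => /orP[]->; rewrite !orbT.
have near_ext : (exists j, [/\ j < k, adjE E i j & s j = SA]) ->
    exists j, [/\ j < k', adjE (F ++ E) i j & s' j = SA].
  by case=> j [jk ij sj]; exists j; rewrite ss ?adjF //; split=> //; lia.
case: (s i) => //; first by rewrite /degE count_cat; lia.
case=> w [w' [a [a' [aa' [wk wk' ak ak'] /andP[iw wa] /andP[iw' wa'] [sa sa']]]]].
exists w, w', a, a'; rewrite !adjF ?ss //; split=> //; split; lia.
Qed.

Lemma T1b_dominated k E s : T1b k E s -> forall i, i < k -> dominatedE k E s i.
Proof.
elim=> {k E s} [|k E s v _ IH vk sv|k E s v _ IH vk sv dv] i ik.
- by case: i ik => [|[|[|]]] // _; rewrite /dominatedE //=; exists 1.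
- have [{}ik|ki] := ltnP i k.
    apply: (dominatedE_ext [:: _] ik _ _ (IH i ik)) => // j jk.
    by rewrite ltn_eqF.
  have -> : i = k by lia.
  rewrite /dominatedE eqxx; exists v; rewrite ltn_eqF // sv /adjE mem_head orbT.
  by split=> //; lia.
rewrite -/(status_O3 k s); have [st0 st1 st2 st3] := status_O3_new k s.
have [{}ik|ki] := ltnP i k.
  apply: (dominatedE_ext [:: _; _; _; _] ik _ _ (IH i ik)); first by lia.
  exact: status_O3_old.
have := IH v vk; rewrite /dominatedE sv => -[j [jk vj sj]].
have adj a b E' : adjE ((a, b) :: E') a b && adjE ((a, b) :: E') b a.
  by rewrite /adjE !mem_head orbT.
have adjW a b p E' : adjE E' a b -> adjE (p :: E') a b.
  by rewrite /adjE !inE => /orP[]->; rewrite !orbT.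
have [->|[->|[->|->]]] : i = k \/ i = k.+1 \/ i = k.+2 \/ i = k.+3 by lia.
(* The two walks from $u_1$ go through [v] to its neighbour [j] of status A, and through $u_2$ to
   $u_3$. *)
- rewrite st0; exists v, k.+1, j, k.+2; split; first by lia.
  + by split; lia.
  + by rewrite (andP (adj _ _ _)).2 !adjW.
  + by rewrite adjW ?(andP (adj _ _ _)).1 //; do 2 apply/adjW; rewrite (andP (adj _ _ _)).1.
  by rewrite status_O3_old.
- rewrite st1; exists k.+2; split=> //; first by lia.
  by do 2 apply/adjW; rewrite (andP (adj _ _ _)).1.
- by rewrite st2 !degE_cons /= !eqxx !orbT /=; lia.
rewrite st3; exists k.+2; split=> //; first by lia.
by do 3 apply/adjW; rewrite (andP (adj _ _ _)).2.
Qed.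

(** $P_3$ gives 1 + 3 = 4. Operation O_1 adds a leaf at a vertex of degree at least 2 and changes
    neither side. Operation O_3 adds one vertex of status A and four non-leaves: $u_1$, $u_2$, $u_3$
    and the former leaf [v]. *)
Lemma T1b_count k E s : T1b k E s ->
  \sum_(i < k) (degE E i != 1) + 3 = 4 * \sum_(i < k) isA (s i).
Proof.
elim=> {k E s} [|k E s v T1 IH vk sv|k E s v T1 IH vk sv dv].
- by rewrite !big_ord_recr !big_ord0.
- have [E_ok _] := T1b_edges T1; have := T1b_dominated T1 vk.
  rewrite /dominatedE sv => dv; rewrite !big_ord_recr /= eqxx.
  have -> : degE ((v, k) :: E) k = 1.
    by rewrite degE_cons (degE_out E_ok) //= eqxx orbT.
  rewrite !addn0; rewrite (eq_bigr (fun i : 'I_k => degE E i != 1 : nat)).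
    by rewrite IH; congr (4 * _); apply: eq_bigr => i _; rewrite ltn_eqF.
  move=> i _; congr (nat_of_bool (~~ _)); rewrite degE_cons /=.
  have := ltn_ord i; have [<-|_] := eqVneq v i => ik; lia.
have [E_ok _] := T1b_edges T1.
rewrite -[\sum_(i < k + 4) isA _]/(\sum_(i < k + 4) isA (status_O3 k s i)) addn4.
rewrite !big_ord_recr /=.
have [-> -> -> ->] := status_O3_new k s.
set E' := _ :: _.
have dE i : degE E' i = ((v == i) || (k == i)) + (((k == i) || (k.+1 == i)) +
    (((k.+1 == i) || (k.+2 == i)) + (((k.+2 == i) || (k.+3 == i)) + degE E i))) by [].
have -> : degE E' k = 2 by rewrite dE (degE_out E_ok) //; lia.
have -> : degE E' k.+1 = 2 by rewrite dE (degE_out E_ok) //; lia.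
have -> : degE E' k.+2 = 2 by rewrite dE (degE_out E_ok) //; lia.
have -> : degE E' k.+3 = 1 by rewrite dE (degE_out E_ok) //; lia.
have -> : \sum_(i < k) (degE E' i != 1) = \sum_(i < k) (degE E i != 1) + 1.
  rewrite (bigD1 (Ordinal vk)) // [in RHS](bigD1 (Ordinal vk)) //=.
  rewrite dE dv eqxx /=.
  have -> : \sum_(i < k | i != Ordinal vk) (degE E' i != 1) =
      \sum_(i < k | i != Ordinal vk) (degE E i != 1).
    apply: eq_bigr => i; rewrite -val_eqE /= eq_sym dE => /negPf->.
    by congr (nat_of_bool (~~ (_ == _))); have := ltn_ord i; lia.
  have [-> -> -> ->] : [/\ k == v = false, k.+1 == v = false, k.+2 == v = false &
    k.+3 == v = false] by split; lia.
  by rewrite /= add0n addnC.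
rewrite (eq_bigr (fun i : 'I_k => isA (s i) : nat)); first by rewrite /= !addn0 mulnDr -IH -!addnA.
by move=> i _; rewrite status_O3_old.
Qed.

Lemma inT1_2DD (V : finType) (e : rel V) (S : V -> status) : inT1 e S ->
  exists2 D, is2DD e D & 4 * #|D| = #|V| - nleaves e + 3.
Proof.
case=> k [E [s [f [T1 f_inj fk Vk [eE SE]]]]]; have [E_ok _] := T1b_edges T1.
pose h v : 'I_k := Ordinal (fk v).
have h_inj : injective h by move=> u v [] /f_inj.
have h_bij : bijective h by apply: inj_card_bij h_inj _; rewrite card_ord Vk.
have [g hK gK] := h_bij.
have fg i (ik : i < k) : f (g (Ordinal ik)) = i by have := congr1 val (gK (Ordinal ik)).
have sumE (F : nat -> nat) : \sum_(i < k) F i = \sum_v F (f v).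
  exact: (reindex h (onW_bij _ h_bij)).
exists [set v | isA (S v)].
  apply/forallP=> v; apply/implyP; rewrite inE => SvA.
  rewrite -implyNb; apply/implyP=> noA.
  have no_nbrA i : i < k -> s i = SA -> ~~ adjE E (f v) i.
    move=> ik siA; apply: contra noA => vi; apply/exists_inP.
    by exists (g (Ordinal ik)); rewrite ?inE ?SE ?eE fg ?siA.
  have := T1b_dominated T1 (fk v); rewrite /dominatedE.
  case sv: (s (f v)); first by rewrite SE sv in SvA.
  - by case=> j [jk vj sj]; have := no_nbrA j jk sj; rewrite vj.
  - by case=> j [jk vj sj]; have := no_nbrA j jk sj; rewrite vj.
  case=> w [w' [a [a' [aa' [wk wk' ak ak'] /andP[vw wa] /andP[vw' wa'] [sa sa']]]]].
  (* As [v] neither has status A nor has a neighbour of that status, a walk of length 2 to a vertex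
     of status A realizes distance exactly 2. *)
  have at2 b c (bk : b < k) (ck : c < k) : s c = SA -> adjE E (f v) b -> adjE E b c ->
      g (Ordinal ck) \in [set u in [set v0 | isA (S v0)] | dist2 e v u].
    move=> sc vb bc; rewrite !inE SE fg sc /dist2 eE fg no_nbrA //=.
    apply/andP; split; first by apply: contraNneq SvA => ->; rewrite SE fg sc.
    by apply/existsP; exists (g (Ordinal bk)); rewrite !eE !fg vb bc.
  apply/card_gt1P; exists (g (Ordinal ak)), (g (Ordinal ak')).
  split; [exact: at2 wk _ sa vw wa | exact: at2 wk' _ sa' vw' wa' |].
  by apply: contra aa' => /eqP/(congr1 f); rewrite !fg => ->.
have degE' v : deg e v = degE E (f v).
  rewrite (degE_sum _ E_ok) (sumE (fun j => adjE E (f v) j : nat)) deg_sum.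
  by apply: eq_bigr => u _; rewrite eE.
have := T1b_count T1; rewrite (sumE (fun i => degE E i != 1 : nat)).
rewrite (sumE (fun i => isA (s i) : nat)) nonleaf_card.
have -> : #|[set v | isA (S v)]| = \sum_v isA (s (f v)).
  rewrite -sum1dep_card big_mkcond; apply: eq_bigr => v _.
  by rewrite SE; case: (isA _).
by move=> <-; congr (_ + _); apply: eq_bigr => v _; rewrite degE'.
Qed.

(** * Edge lists placed inside an acyclic graph *)

Section Growth.
Variables (V : finType) (e : rel V) (x0 : V).
Hypotheses (e_sym : symmetric e) (e_irr : irreflexive e) (e_acy : acyclic e).

(* The list [ws] places the vertices [0, 1, ...] of an edge list inside [V]. *)
Definition sound (ws : seq V) (E : seq (nat * nat)) : bool :=
  all (fun p => e (nth x0 ws p.1) (nth x0 ws p.2)) E.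

Lemma sound_cat ws t E : edges_ok (size ws) E -> sound ws E -> sound (ws ++ t) E.
Proof.
case/andP=> _ /allP Ek /allP sE; apply/allP=> p pE; have /= := Ek p pE.
by rewrite !nth_cat => /andP[p12 p2]; rewrite p2 (ltn_trans p12 p2); exact: sE.
Qed.

(** The degree sum of the list is at most that of the subgraph induced on [ws], which
    [acyclic_edge_bound] controls. *)
Lemma sound_edge_bound ws E : uniq ws -> edges_ok (size ws) E -> sound ws E ->
  0 < size ws -> size E < size ws.
Proof.
move=> ws_uniq E_ok /allP sE ws0; pose W := [set z in ws].
have cW : #|W| = size ws by rewrite cardsE; apply/card_uniqP.
have sumW (F : V -> nat) : \sum_(z in W) F z = \sum_(i < size ws) F (nth x0 ws i).
  rewrite (eq_bigl (fun z => z \in ws)) => [|z]; last by rewrite inE.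
  by rewrite -big_uniq // (big_nth x0) big_mkord.
have := acyclic_edge_bound e_sym e_irr e_acy (W := W).
rewrite -card_gt0 cW => /(_ ws0); rewrite sumW.
suff : 2 * size E <= \sum_(i < size ws) \sum_(u in W) e (nth x0 ws i) u by lia.
rewrite -(sum_degE E_ok); apply: leq_sum => i _; rewrite (degE_sum _ E_ok) sumW.
apply: leq_sum => j _; case: (boolP (adjE E i j)) => // /orP[] /sE /= ij.
  by rewrite ij.
by rewrite e_sym ij.
Qed.

Section Ears.
Variables (ws : seq V) (E : seq (nat * nat)).
Hypotheses (ws_uniq : uniq ws) (E_ok : edges_ok (size ws) E).
Hypotheses (E_sound : sound ws E) (E_size : size E + 1 = size ws).

(* [E] already is a spanning tree of [ws], so an ear [t] attached to [ws] by one
   edge too many would close a cycle. *)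
Lemma no_ear (t : seq V) F : uniq (ws ++ t) -> uniq F ->
  all (fun p => p.1 < p.2 < size ws + size t) F ->
  all (fun p => size ws <= p.2) F ->
  sound (ws ++ t) F -> size F <= size t.
Proof.
move=> t_uniq Fu Fk Fws sF; have E'_ok : edges_ok (size (ws ++ t)) (F ++ E).
  by rewrite size_cat; apply: (edges_ok_cat E_ok) => //; lia.
have E'_sound : sound (ws ++ t) (F ++ E).
  by rewrite /sound all_cat -!/(sound _ _) sF sound_cat.
have ws0 : 0 < size (ws ++ t) by rewrite size_cat -E_size addn1.
have := sound_edge_bound t_uniq E'_ok E'_sound ws0.
by rewrite !size_cat -E_size (addnC (size F)) -addnA ltn_add2l.
Qed.

(** Otherwise [u] would be an ear with one vertex and two edges. *)
Lemma one_nbr_inside u a b : u \notin ws -> a \in ws -> b \in ws ->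
  e a u -> e b u -> a = b.
Proof.
move=> uws aws bws au bu; apply/eqP; apply: contraT => ab.
have uu : uniq (ws ++ [:: u]) by rewrite cats1 rcons_uniq uws.
have := @no_ear [:: u] [:: (index a ws, size ws); (index b ws, size ws)] uu.
rewrite /sound /= !inE !xpair_eqE eqxx andbT !nth_cat !index_mem aws bws ltnn subnn.
rewrite !nth_index //= au bu !leqnn /=.
have /negPf-> : index a ws != index b ws.
  by apply: contra ab => /eqP ab; rewrite -(nth_index x0 aws) ab nth_index.
by rewrite addn1 ltnSn => /(_ isT isT isT isT).
Qed.

(** The path from [a] through [u] and [v] to [b] would be an ear with two vertices and three
    edges. *)
Lemma no_ear2 u v a b : u \notin ws -> v \notin ws -> u != v ->
  a \in ws -> b \in ws -> e a u -> e u v -> ~~ e b v.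
Proof.
move=> uws vws uv aws bws au uv_e; apply/negP=> bv.
have uu : uniq (ws ++ [:: u; v]).
  by rewrite cat_uniq ws_uniq /= !inE uv (negPf uws) (negPf vws).
have := @no_ear [:: u; v] [:: (index a ws, size ws); (size ws, (size ws).+1);
  (index b ws, (size ws).+1)] uu.
have -> : sound (ws ++ [:: u; v]) [:: (index a ws, size ws); (size ws, (size ws).+1);
    (index b ws, (size ws).+1)].
  rewrite /sound /= !nth_cat !index_mem aws bws ltnn subnn ltnNge leqnSn subSnn /=.
  by rewrite !nth_index // au bv uv_e.
have := aws; have := bws; rewrite -!index_mem => bk ak.
rewrite /= !inE !xpair_eqE !leqnn addn2 !ltnS !leqnSn !andbT.
by rewrite !leqnn ak (ltnW bk) (ltn_eqF (ltnSn _)) (gtn_eqF bk) !andbF => /(_ isT isT isT isT).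
Qed.

(** An edge inside [ws] missing from [E] could be added to it, giving as many edges as vertices. *)
Lemma induced_adj a b : a \in ws -> b \in ws -> e a b = adjE E (index a ws) (index b ws).
Proof.
(* Ordering by index is what [edges_ok] requires of the added pair; symmetry covers the other
   order. *)
have up c d : c \in ws -> d \in ws -> index c ws < index d ws -> e c d ->
    adjE E (index c ws) (index d ws).
  move=> cws dws cd ecd; apply: contraT => nE.
  have := @sound_edge_bound ws ((index c ws, index d ws) :: E) ws_uniq.
  move: E_ok => /andP[Eu Ek]; move: nE; rewrite /adjE negb_or => /andP[nE _].
  rewrite /edges_ok /= nE Eu Ek cd index_mem dws /sound /= !nth_index // ecd.
  by rewrite -/(sound _ _) E_sound -E_size addn1 ltnn => /(_ isT isT isT).
move=> aws bws; apply/idP/idP => [ab|]; last first.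
  by case/orP=> /(allP E_sound) /=; rewrite !nth_index // e_sym.
have [ltab|ltba|eqab] := ltngtP (index a ws) (index b ws); first exact: up.
  by rewrite /adjE orbC -/(adjE _ _ _) up // e_sym.
by rewrite -(nth_index x0 aws) eqab nth_index // e_irr in ab.
Qed.
End Ears.
End Growth.

(** * Rebuilding the tree in the case of equality *)

Lemma ltn_add4 j k :
  j < k + 4 -> [\/ j < k, j = k, j = k.+1 | j = k.+2 \/ j = k.+3].
Proof.
have [jk _|kj jk4] := ltnP j k; first exact: Or41.
have [->|[->|[->|->]]] : j = k \/ j = k.+1 \/ j = k.+2 \/ j = k.+3 by lia.
- exact: Or42.
- exact: Or43.
- by apply: Or44; left.
by apply: Or44; right.
Qed.

Definition edges_O3 (k : nat) (E : seq (nat * nat)) (v : nat) :=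
  (v, k) :: (k, k.+1) :: (k.+1, k.+2) :: (k.+2, k.+3) :: E.

Lemma degE_O3_old k E v j : j < k -> degE (edges_O3 k E v) j = (v == j) + degE E j.
Proof. by move=> jk; rewrite !degE_cons /=; congr (_ + _); lia. Qed.

Lemma degE_O3_last k E v : edges_ok k E -> v < k -> degE (edges_O3 k E v) k.+3 = 1.
Proof. by move=> E_ok vk; rewrite !degE_cons (degE_out E_ok) /=; lia. Qed.

Section Build.
Variables (V : finType) (e : rel V) (D : {set V}) (x0 : V).
Hypotheses (e_tree : is_tree e) (V2 : 2 <= #|V|) (tightD : forall v, tight e D v).

Let e_sym : symmetric e. Proof. by case: e_tree => -[]. Qed.
Let e_irr : irreflexive e. Proof. by case: e_tree => -[]. Qed.
Let e_acy : acyclic e. Proof. by case: e_tree. Qed.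
Let e_conn : forall x y, connect e x y. Proof. by case: e_tree. Qed.

Definition closed_in (ws : seq V) (v : V) : Prop := forall u, e v u -> u \in ws.

(** Status A marks exactly the placed vertices of [D]. The last three fields control the edges
    leaving [ws]: none starts at a far vertex, none joins a near vertex to [D], and a near vertex
    with an unplaced neighbour is still a leaf of status C, ready for O_3. *)
Record partial_tree (ws : seq V) (E : seq (nat * nat)) (s : nat -> status) : Prop :=
  PartialTree {
    pt_uniq : uniq ws;
    pt_T1 : T1b (size ws) E s;
    pt_sound : sound e x0 ws E;
    pt_status : forall i, i < size ws -> isA (s i) = (nth x0 ws i \in D);
    pt_center : forall v d, v \in ws -> v \in near e D -> d \in D -> e v d -> d \in ws;
    pt_far : forall v, v \in ws -> v \in far e D -> closed_in ws v;
    pt_near : forall i, i < size ws -> nth x0 ws i \in near e D ->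
      (s i = SC /\ degE E i = 1) \/ closed_in ws (nth x0 ws i)
  }.

Lemma closed_in_cat ws t v : closed_in ws v -> closed_in (ws ++ t) v.
Proof. by move=> cl u /cl; rewrite mem_cat => ->. Qed.

Lemma center_two_nbrs d x : d \in D -> exists2 y, e d y & y != x.
Proof.
move=> Dd; apply: other_nbr; have := center_deg tightD Dd.
by have := connected_deg_gt0 e_conn V2 d; lia.
Qed.

Lemma partial_tree_base d : d \in D ->
  exists ws E s, partial_tree ws E s.
Proof.
move=> Dd; have [a da _] := center_two_nbrs d Dd.
have [b db ba] := center_two_nbrs a Dd.
have aN := near_nbr e_sym tightD Dd da; have bN := near_nbr e_sym tightD Dd db.
have [aD bD] := (near_notin aN, near_notin bN).
exists [:: a; d; b], [:: (0, 1); (1, 2)], (fun i => if i == 1 then SA else SC).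
have ad : a != d by apply: contraTneq Dd => <-; rewrite aD.
have dNb : d != b by apply: contraTneq Dd => ->; rewrite bD.
split.
- by rewrite /= !inE (eq_sym a b) negb_or ad dNb ba.
- exact: T1_base.
- by rewrite /sound /= e_sym da db.
- by case=> [|[|[|]]] //=; rewrite ?aD ?bD ?Dd.
- move=> v d' vt vN Dd' vd'; move: vt.
  rewrite !inE => /or3P[] /eqP vE; rewrite {}vE in vN vd'.
  + by rewrite (near_center_unique tightD aN Dd' Dd vd') ?eqxx ?orbT // e_sym.
  + by rewrite (near_notin vN) in Dd.
  by rewrite (near_center_unique tightD bN Dd' Dd vd') ?eqxx ?orbT // e_sym.
- move=> v; rewrite [v \in _ :: _]inE => /predU1P[->|].
    by move/far_not_near; rewrite aN.
  rewrite !in_cons orbF => /orP[]/eqP-> vF; last by rewrite (far_not_near vF) in bN.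
  by rewrite (far_notin vF) in Dd.
by case=> [|[|[|]]] //= _; [left | move/near_notin; rewrite Dd | left].
Qed.

(** Operation O_1 at a vertex of [D]. *)
Lemma partial_tree_leaf ws E s i u : partial_tree ws E s -> i < size ws ->
  nth x0 ws i \in D -> e (nth x0 ws i) u -> u \notin ws ->
  partial_tree (ws ++ [:: u]) ((i, size ws) :: E)
    (fun j => if j == size ws then SC else s j).
Proof.
move=> [ws_uniq T1 E_sound st center farP nearP] ik iD iu uws.
have [E_ok _] := T1b_edges T1.
have uN := near_nbr e_sym tightD iD iu; have uD := near_notin uN.
have szE : size (ws ++ [:: u]) = (size ws).+1 by rewrite size_cat addn1.
have old j : j < size ws -> nth x0 (ws ++ [:: u]) j = nth x0 ws j.
  by rewrite nth_cat => ->.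
have new : nth x0 (ws ++ [:: u]) (size ws) = u by rewrite nth_cat ltnn subnn.
split.
- by rewrite cats1 rcons_uniq uws.
- by rewrite szE; apply: T1_O1 => //; apply/isAP; rewrite st.
- rewrite /sound /= new old // iu /=; exact: sound_cat.
- move=> j; rewrite szE ltnS leq_eqVlt => /predU1P[->|jk].
    by rewrite eqxx new uD.
  by rewrite old // ltn_eqF ?st.
- move=> v d; rewrite !mem_cat => /orP[vws|vt] vN Dd vd.
    by rewrite (center v d).
  move: vt; rewrite !inE => /eqP vE; rewrite {}vE in vN vd.
  by rewrite (near_center_unique tightD uN Dd iD vd) ?mem_nth // e_sym.
- move=> v; rewrite mem_cat => /orP[vws|vt] vF; first exact/closed_in_cat/farP.
  move: vt; rewrite !inE => /eqP vE; rewrite {}vE in vF.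
  by rewrite (far_not_near vF) in uN.
move=> j; rewrite szE ltnS leq_eqVlt => /predU1P[->|jk].
  by rewrite eqxx new => _; left; rewrite degE_cons (degE_out E_ok) // eqxx orbT.
rewrite old // ltn_eqF // => jN; have [[sj dj]|cl] := nearP j jk jN.
  left; split=> //; rewrite degE_cons dj.
  (* The degree of a near vertex [j] is unchanged, since the leaf is attached at a vertex of [D]. *)
  suff -> : (i == j) = false by rewrite gtn_eqF.
  by apply: contraTF jN => /eqP<-; apply/negP=> /near_notin; rewrite iD.
by right; apply: closed_in_cat.
Qed.

(** Operation O_3: tightness forces the path [u], [y], [c], [b] to have types far, near, [D], near,
    and acyclicity with [pt_center] keeps it outside [ws]. *)
Lemma partial_tree_path ws E s i u : partial_tree ws E s -> i < size ws ->
  nth x0 ws i \in near e D -> e (nth x0 ws i) u -> u \notin ws ->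
  exists ws' E' s', partial_tree ws' E' s' /\ size ws < size ws'.
Proof.
move=> [ws_uniq T1 E_sound st center farP nearP] ik xN xu uws.
have [E_ok szE] := T1b_edges T1; set x := nth x0 ws i in xN xu.
have xws : x \in ws by rewrite mem_nth.
have [|[si di]|cl] := nearP i ik; first exact: xN; last by rewrite cl in uws.
have [d [Dd xd]] : exists d, d \in D /\ e x d.
  by move: (xN); rewrite inE => /andP[_ /exists_inP[d]]; exists d.
have uD : u \notin D by apply: contra uws => Du; apply: (center x).
have [uF _] := near_nbrs tightD xN Dd xd uD xu xu.
have x_cl w : e x w -> w = d \/ w = u.
  by move=> xw; have [] := near_nbrs tightD xN Dd xd uD xu xw.
have ux : e u x by rewrite e_sym.
have [y [yx uy _ yN u_cl]] := far_nbrs tightD uF ux.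
(* Otherwise [u] would have the two neighbours [x] and [y] in [ws]. *)
have yws : y \notin ws.
  apply: contra yx => yws; apply/eqP.
  by apply: (one_nbr_inside e_sym e_irr e_acy ws_uniq E_ok E_sound szE uws);
    rewrite // e_sym.
have uNy : u != y by apply: contraTneq yN => <-; rewrite (far_not_near uF).
have [c [Dc yc]] : exists c, c \in D /\ e y c.
  by move: (yN); rewrite inE => /andP[_ /exists_inP[c]]; exists c.
(* Otherwise [u] and [y] would form an ear between [x] and [c]. *)
have cws : c \notin ws.
  apply/negP=> cws.
  have := no_ear2 e_sym e_irr e_acy ws_uniq E_ok E_sound szE uws yws uNy xws cws xu uy.
  by rewrite e_sym yc.
have yu : e y u by rewrite e_sym.
have y_cl w : e y w -> w = c \/ w = u.
  by move=> yw; have [] := near_nbrs tightD yN Dc yc uD yu yw.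
have cy : e c y by rewrite e_sym.
have [b cb yb] := center_two_nbrs y Dc.
have bN := near_nbr e_sym tightD Dc cb.
have bc : e b c by rewrite e_sym.
(* By [pt_center], placing [b] would have placed its neighbour [c] in [D]. *)
have bws : b \notin ws by apply: contra cws => bws; apply: (center b).
have [yD bD] := (near_notin yN, near_notin bN).
have DN z w : z \in D = false -> w \in D -> z != w.
  by move=> zD wD; apply: contraTneq wD => <-; rewrite zD.
have uNb : u != b by apply: contraTneq bN => <-; rewrite (far_not_near uF).
exists (ws ++ [:: u; y; c; b]); set k := size ws.
exists (edges_O3 k E i).
exists (status_O3 k s).
have sz : size (ws ++ [:: u; y; c; b]) = k + 4 by rewrite size_cat.
split; last by rewrite sz -addn1 leq_add2l.
have old j : j < k -> nth x0 (ws ++ [:: u; y; c; b]) j = nth x0 ws j.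
  by rewrite nth_cat -/k => ->.
have new j : nth x0 (ws ++ [:: u; y; c; b]) (k + j) = nth x0 [:: u; y; c; b] j.
  by rewrite nth_cat -/k ltnNge leq_addr addKn.
have := (new 0, new 1, new 2, new 3).
rewrite addn0 addn1 addn2 addn3 /= => -[[[n0 n1] n2] n3].
have [st0 st1 st2 st3] := status_O3_new k s.
split.
- rewrite cat_uniq ws_uniq /= !negb_or uws yws cws bws uNy uNb.
  by rewrite (DN u c (negPf uD) Dc) (DN y c yD Dc) (eq_sym y) yb (eq_sym c) (DN b c bD Dc).
- by rewrite sz; apply: T1_O3.
- by rewrite /sound /= n0 n1 n2 n3 old // xu uy yc cb /=; exact: sound_cat.
- move=> j; rewrite sz => /ltn_add4[jk|->|->|[->|->]].
  + by rewrite old // status_O3_old ?st.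
  + by rewrite st0 n0 (negPf uD).
  + by rewrite st1 n1 yD.
  + by rewrite st2 n2 Dc.
  by rewrite st3 n3 bD.
- move=> v d'; rewrite !mem_cat => /orP[vws|vt] vN Dd' vd'.
    by rewrite (center v d').
  move: vt; rewrite !inE => /or4P[] /eqP vE; rewrite {}vE in vN vd'.
  + by rewrite (far_not_near uF) in vN.
  + by rewrite (near_center_unique tightD yN Dd' Dc vd' yc) eqxx !orbT.
  + by rewrite (near_notin vN) in Dc.
  by rewrite (near_center_unique tightD bN Dd' Dc vd' bc) eqxx !orbT.
- move=> v; rewrite mem_cat => /orP[vws|vt] vF.
    exact/closed_in_cat/farP.
  move: vt; rewrite !inE => /or4P[] /eqP vE; rewrite {}vE in vF *.
  + move=> w /u_cl[]->; rewrite mem_cat; first by rewrite xws.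
    by rewrite !inE eqxx !orbT.
  + by rewrite (far_not_near vF) in yN.
  + by rewrite (far_notin vF) in Dc.
  by rewrite (far_not_near vF) in bN.
move=> j; rewrite sz => /ltn_add4[jk|->|->|[->|->]].
- rewrite old // status_O3_old // => jN; have [ij|ij] := eqVneq i j.
    (* The vertex [x] stops being a leaf, but both its neighbours [d] and [u] are now placed. *)
    right; rewrite -ij -/x => w /x_cl[]->; rewrite mem_cat; last by rewrite mem_head orbT.
    by rewrite (center x d).
  have [[sj dj]|cl] := nearP j jk jN; last by right; apply: closed_in_cat.
  left; split=> //.
  by rewrite degE_O3_old // (negPf ij).
- by rewrite n0 => uN; rewrite (far_not_near uF) in uN.
- by rewrite n1 => _; right=> w /y_cl[]->; rewrite mem_cat !inE eqxx !orbT.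
- by rewrite n2 => cN; rewrite (near_notin cN) in Dc.
rewrite n3 st3 => _; left; split=> //.
by rewrite degE_O3_last.
Qed.

Lemma connected_exit (A : pred V) x y : A x -> ~~ A y ->
  exists a b, [/\ A a, ~~ A b & e a b].
Proof.
move=> Ax Ay; have /connectP[p xp yE] := e_conn x y.
elim: p x Ax xp yE => [|z p IHp] x Ax /=; first by move=> _ yE; rewrite yE Ax in Ay.
by case/andP=> xz zp yE; have [/IHp|nz] := boolP (A z); [exact | exists x, z].
Qed.

(** Induction on the number of unplaced vertices. By connectedness some edge leaves [ws]; its inner
    end lies in [D] and O_1 applies, or it is near and O_3 applies, or it is far, against
    [pt_far]. *)
Lemma partial_tree_grow ws E s : partial_tree ws E s ->
  exists ws' E' s', partial_tree ws' E' s' /\ forall v, v \in ws'.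
Proof.
have [n] := ubnP (#|V| - size ws); elim: n ws E s => // n IHn ws E s lt_n pt.
have [/forallP all_ws|/forallPn[y yws]] := boolP [forall v, v \in ws].
  by exists ws, E, s.
have ltV : size ws < #|V|.
  rewrite -(card_uniqP (pt_uniq pt)); apply: proper_card.
  by apply/properP; split; [exact/subsetP | exists y].
have ws0 : nth x0 ws 0 \in ws.
  by apply: mem_nth; have [_ <-] := T1b_edges (pt_T1 pt); rewrite addn1.
have [a [u [aws uws au]]] := connected_exit (A := mem ws) ws0 yws.
have ik : index a ws < size ws by rewrite index_mem.
have aE : nth x0 ws (index a ws) = a by rewrite nth_index.
rewrite -aE in au; have [aA|aA|aA] := vertexP e D a.
- have aD : nth x0 ws (index a ws) \in D by rewrite aE.
  apply: IHn (partial_tree_leaf pt ik aD au uws).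
  by apply: leq_trans (ltn_sub2l ltV _) lt_n; rewrite size_cat addn1.
- have aN : nth x0 ws (index a ws) \in near e D by rewrite aE.
  have [ws' [E' [s' [pt' lt']]]] := partial_tree_path pt ik aN au uws.
  exact: IHn (leq_trans (ltn_sub2l ltV lt') lt_n) pt'.
by rewrite aE in au; rewrite /= (pt_far pt aws aA au) in uws.
Qed.

(** Once every vertex is placed, [induced_adj] identifies the tree with the edge list, positions in
    [ws] giving the isomorphism. *)
Lemma tight_inT1 : D != set0 -> exists S : V -> status, inT1 e S.
Proof.
case/set0Pn=> d /partial_tree_base[ws [E [s /partial_tree_grow]]].
case=> {}ws [{}E [{}s [[ws_uniq T1 E_sound _ _ _ _] all_ws]]].
have [E_ok szE] := T1b_edges T1.
exists (fun v => s (index v ws)), (size ws), E, s, (fun v => index v ws); split=> //.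
- by move=> u v uv; rewrite -(nth_index x0 (all_ws u)) uv nth_index.
- by move=> v; rewrite index_mem.
- by rewrite -(card_uniqP ws_uniq); apply: eq_card => v; rewrite all_ws.
by split=> // u v; apply: (induced_adj e_sym e_irr e_acy ws_uniq E_ok E_sound szE).
Qed.
End Build.

(** * The bound and its extremal trees *)

Theorem theorem2p3 (V : finType) (e : rel V) :
  is_tree e -> 2 <= #|V| ->
  (#|V| - nleaves e + 3 <= 4 * gamma2d e) /\
  (4 * gamma2d e = #|V| - nleaves e + 3 <-> exists S : V -> status, inT1 e S).
Proof.
move=> e_tree V2; rewrite /gamma2d.
case: arg_minnP => [|D D_2DD D_min]; first by apply/forallP=> v; rewrite inE.
have [bound tightD] := tree_2DD_bound e_tree V2 D_2DD.
split=> //; split=> [eqD|[S /inT1_2DD[D' D'_2DD eqD']]]; last first.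
  (* The minimum is at most the size of [D'], which meets the lower bound. *)
  by have := D_min D' D'_2DD; lia.
have /card_gt0P[x0 _] : 0 < #|V| by lia.
apply: (tight_inT1 x0 e_tree V2 (tightD eqD)).
(* [D] is nonempty because four times its size is at least 3. *)
by rewrite -card_gt0; lia.
Qed.
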